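(* $\mathsf{BIM}\vdash\mathbf{Ded}\rightarrow\mathbf{LPO}$, where $\mathbf{Ded}$: for every sequence $\gamma$ of rationals with $\forall n[\gamma(n)\le\gamma(n+1)\le1]$, there is a strictly increasing $\zeta:\mathbb N\to\mathbb N$ with $\forall n[\gamma(\zeta(n+1))\le\gamma(\zeta(n))+\frac1{2^n}]$; $\mathbf{LPO}$: for every $\alpha\in\mathbb N^{\mathbb N}$, $\exists n[\alpha(n)\ne0]\vee\forall n[\alpha(n)=0]$.
   Context: $\mathsf{BIM}$ is the two-sorted formal theory with intuitionistic logic of natural numbers and functions $\mathbb N\to\mathbb N$, with extensionality, constants and defining equations for primitive recursive functions (including a coding of rationals by naturals), closure of functions under composition, primitive recursion and unbounded search, and the induction scheme for all formulas. Sequences of rationals are functions $\mathbb N\to\mathbb N$ whose values are codes of rationals. *)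

(* Defs.v *)
From Stdlib Require Import List.
Import ListNotations.

(** The language of BIM has two sorts: natural numbers, and functions from naturals to naturals.
    Variables of each sort are de Bruijn indices, counted separately: a number
    quantifier does not affect the indices of function variables, nor conversely.

    The only number symbols that are not unary functions are zero and the
    (surjective) pairing [Pr]; a function of several arguments is applied to
    the pair of its arguments, [(x, y, z)] being coded as [Pr (Pr x y) z]. *)

(** Constants for primitive recursive functions, generated from the identity, the
    zero function, the successor and the two projections of the pairing
    by composition, pairing and primitive recursion (see [BIM] for the defining
    equations). *)
Inductive prim : Type :=
| pId | pZero | pSucc | pFst | pSnd
| pComp (f g : prim)
| pPair (f g : prim)
| pRec (f g : prim).

Inductive fterm : Type :=
| FVar (i : nat)
| FCst (f : prim).
Coercion FCst : prim >-> fterm.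

Inductive term : Type :=
| Var (i : nat)
| Zero
| Pr (s t : term)
| App (f : fterm) (t : term).

Inductive form : Type :=
| Eq0 (s t : term)
| Eq1 (f g : fterm)
| Bot
| And (A B : form)
| Or (A B : form)
| Imp (A B : form)
| All0 (A : form)
| Ex0 (A : form)
| All1 (A : form)
| Ex1 (A : form).

Declare Scope bim_scope.
Delimit Scope bim_scope with bim.
Bind Scope bim_scope with form.
Bind Scope bim_scope with term.
Bind Scope bim_scope with fterm.
Open Scope bim_scope.

Notation "f @ t" := (App f t) (at level 15, right associativity) : bim_scope.
Notation "s =_0 t" := (Eq0 s t) (at level 70) : bim_scope.
Notation "f =_1 g" := (Eq1 f g) (at level 70) : bim_scope.
Notation "A /\ B" := (And A B) : bim_scope.
Notation "A \/ B" := (Or A B) : bim_scope.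
Notation "A --> B" := (Imp A B) (at level 90, right associativity) : bim_scope.
Notation "~ A" := (Imp A Bot) : bim_scope.

Notation Sc t := (App (FCst pSucc) t).
Notation Fst t := (App (FCst pFst) t).
Notation Snd t := (App (FCst pSnd) t).

Definition Iff (A B : form) : form := (A --> B) /\ (B --> A).

Definition fsubst (sf : nat -> fterm) (f : fterm) : fterm :=
  match f with FVar i => sf i | FCst c => FCst c end.

Fixpoint tsubst (sn : nat -> term) (sf : nat -> fterm) (t : term) : term :=
  match t with
  | Var i => sn i
  | Zero => Zero
  | Pr s t => Pr (tsubst sn sf s) (tsubst sn sf t)
  | App f t => App (fsubst sf f) (tsubst sn sf t)
  end.

Definition scons {X : Type} (x : X) (s : nat -> X) (i : nat) : X :=
  match i with O => x | S j => s j end.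

Definition upVar (i : nat) : term := Var (S i).
Definition upFVar (i : nat) : fterm := FVar (S i).

Fixpoint subst (sn : nat -> term) (sf : nat -> fterm) (A : form) : form :=
  let sn0 := scons (Var 0) (fun i => tsubst upVar FVar (sn i)) in
  let sn1 := fun i => tsubst Var upFVar (sn i) in
  let sf1 := scons (FVar 0) (fun i => fsubst upFVar (sf i)) in
  match A with
  | Eq0 s t => Eq0 (tsubst sn sf s) (tsubst sn sf t)
  | Eq1 f g => Eq1 (fsubst sf f) (fsubst sf g)
  | Bot => Bot
  | And A B => And (subst sn sf A) (subst sn sf B)
  | Or A B => Or (subst sn sf A) (subst sn sf B)
  | Imp A B => Imp (subst sn sf A) (subst sn sf B)
  | All0 A => All0 (subst sn0 sf A)
  | Ex0 A => Ex0 (subst sn0 sf A)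
  | All1 A => All1 (subst sn1 sf1 A)
  | Ex1 A => Ex1 (subst sn1 sf1 A)
  end.

Definition tshift0 : term -> term := tsubst upVar FVar.
Definition shift0 : form -> form := subst upVar FVar.
Definition shift1 : form -> form := subst Var upFVar.
Definition inst0 (t : term) : form -> form := subst (scons t Var) FVar.
Definition inst1 (f : fterm) : form -> form := subst Var (scons f FVar).

(** [succ0 A] replaces the number variable 0 of [A] by its successor. *)
Definition succ0 : form -> form := subst (scons (Sc (Var 0)) upVar) FVar.

Definition pAdd : prim := pRec pId (pComp pSucc pSnd).
Definition pMul : prim :=
  pRec pZero (pComp pAdd (pPair pSnd (pComp pFst pFst))).
Definition pExp : prim :=
  pRec (pComp pSucc pZero) (pComp pMul (pPair pSnd (pComp pFst pFst))).
Definition pPred : prim :=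
  pComp (pRec pZero (pComp pSnd pFst)) (pPair pZero pId).

Definition add (s t : term) : term := pAdd @ (Pr s t).
Definition mul (s t : term) : term := pMul @ (Pr s t).
Definition exp (s t : term) : term := pExp @ (Pr s t).
Definition pred (t : term) : term := pPred @ t.

Notation one := (Sc Zero).
Notation two := (Sc one).

Definition le (s t : term) : form :=
  Ex0 (add (tshift0 s) (Var 0) =_0 tshift0 t).
Definition lt (s t : term) : form := le (Sc s) t.

(** Axioms with free variables stand for their universal closures. *)
Inductive BIM : form -> Prop :=
| ax_ext :
    BIM (All1 (All1 (Iff (FVar 1 =_1 FVar 0)
                         (All0 (FVar 1 @ Var 0 =_0 FVar 0 @ Var 0)))))
| ax_succ_neq0 t : BIM (~ (Sc t =_0 Zero))
| ax_succ_inj s t : BIM (Sc s =_0 Sc t --> s =_0 t)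
| ax_fst s t : BIM (Fst (Pr s t) =_0 s)
| ax_snd s t : BIM (Snd (Pr s t) =_0 t)
| ax_pair t : BIM (Pr (Fst t) (Snd t) =_0 t)
| ax_id t : BIM (pId @ t =_0 t)
| ax_zero t : BIM (pZero @ t =_0 Zero)
| ax_comp f g t : BIM ((pComp f g) @ t =_0 f @ g @ t)
| ax_pPair f g t : BIM ((pPair f g) @ t =_0 Pr (f @ t) (g @ t))
| ax_rec0 f g s : BIM ((pRec f g) @ (Pr s Zero) =_0 f @ s)
| ax_recS f g s t :
    BIM ((pRec f g) @ (Pr s (Sc t))
         =_0 g @ (Pr (Pr s t) ((pRec f g) @ (Pr s t))))
(* for all a, b there is c with c(n) = a(b(n)) for all n *)
| ax_closed_comp :
    BIM (All1 (All1 (Ex1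
      (All0 (FVar 0 @ Var 0 =_0 FVar 2 @ FVar 1 @ Var 0)))))
(* for all a, b there is c with c(m,0) = a(m) and
   c(m,n+1) = b(m,n,c(m,n)) for all m, n *)
| ax_closed_rec :
    BIM (All1 (All1 (Ex1
      (All0 (FVar 0 @ (Pr (Var 0) Zero) =_0 FVar 2 @ Var 0
             /\ All0 (FVar 0 @ (Pr (Var 1) (Sc (Var 0)))
                      =_0 FVar 1 @ (Pr (Pr (Var 1) (Var 0))
                                       (FVar 0 @ (Pr (Var 1) (Var 0))))))))))
(* if for all m there is n with a(m,n) = 0, then there is c such that, for
   all m, c(m) is the least n with a(m,n) = 0 *)
| ax_closed_search :
    BIM (All1
      (All0 (Ex0 (FVar 0 @ (Pr (Var 1) (Var 0)) =_0 Zero)) -->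
       Ex1 (All0
         (FVar 1 @ (Pr (Var 0) (FVar 0 @ Var 0)) =_0 Zero
          /\ All0 (lt (Var 0) (FVar 0 @ Var 1) -->
                   ~ (FVar 1 @ (Pr (Var 1) (Var 0)) =_0 Zero))))))
| ax_ind A :
    BIM (inst0 Zero A --> All0 (A --> succ0 A) --> All0 A).

(** Natural deduction for two-sorted intuitionistic logic with equality, from the
    axioms [Ax] and the list of assumptions [G]. *)
Inductive deriv (Ax : form -> Prop) : list form -> form -> Prop :=
| d_ax G A : Ax A -> deriv Ax G A
| d_hyp G A : In A G -> deriv Ax G A
| d_botE G A : deriv Ax G Bot -> deriv Ax G A
| d_andI G A B : deriv Ax G A -> deriv Ax G B -> deriv Ax G (A /\ B)
| d_andE1 G A B : deriv Ax G (A /\ B) -> deriv Ax G A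
| d_andE2 G A B : deriv Ax G (A /\ B) -> deriv Ax G B
| d_orI1 G A B : deriv Ax G A -> deriv Ax G (A \/ B)
| d_orI2 G A B : deriv Ax G B -> deriv Ax G (A \/ B)
| d_orE G A B C :
    deriv Ax G (A \/ B) -> deriv Ax (A :: G) C -> deriv Ax (B :: G) C ->
    deriv Ax G C
| d_impI G A B : deriv Ax (A :: G) B -> deriv Ax G (A --> B)
| d_impE G A B : deriv Ax G (A --> B) -> deriv Ax G A -> deriv Ax G B
| d_all0I G A : deriv Ax (map shift0 G) A -> deriv Ax G (All0 A)
| d_all0E G A t : deriv Ax G (All0 A) -> deriv Ax G (inst0 t A)
| d_ex0I G A t : deriv Ax G (inst0 t A) -> deriv Ax G (Ex0 A)
| d_ex0E G A C :
    deriv Ax G (Ex0 A) -> deriv Ax (A :: map shift0 G) (shift0 C) ->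
    deriv Ax G C
| d_all1I G A : deriv Ax (map shift1 G) A -> deriv Ax G (All1 A)
| d_all1E G A f : deriv Ax G (All1 A) -> deriv Ax G (inst1 f A)
| d_ex1I G A f : deriv Ax G (inst1 f A) -> deriv Ax G (Ex1 A)
| d_ex1E G A C :
    deriv Ax G (Ex1 A) -> deriv Ax (A :: map shift1 G) (shift1 C) ->
    deriv Ax G C
| d_refl0 G t : deriv Ax G (t =_0 t)
| d_leib0 G A s t :
    deriv Ax G (s =_0 t) -> deriv Ax G (inst0 s A) -> deriv Ax G (inst0 t A)
| d_refl1 G f : deriv Ax G (f =_1 f)
| d_leib1 G A f g :
    deriv Ax G (f =_1 g) -> deriv Ax G (inst1 f A) -> deriv Ax G (inst1 g A).

Definition provable (Ax : form -> Prop) (A : form) : Prop := deriv Ax [] A.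

(** The number coded by [((p, m), c)] is the rational [(p - m) / (c + 1)]. As the
    pairing is surjective, every natural number codes a rational; a rational
    has many codes, and [qle] does not depend on the codes chosen. *)

(** The code of [(p - m) / d], for [d > 0]. *)
Definition mkq (p m d : term) : term := Pr (Pr p m) (pred d).

Definition qpos (q : term) : term := Fst (Fst q).
Definition qneg (q : term) : term := Snd (Fst q).
Definition qden (q : term) : term := Sc (Snd q).

Definition qle (q r : term) : form :=
  le (add (mul (qpos q) (qden r)) (mul (qneg r) (qden q)))
     (add (mul (qpos r) (qden q)) (mul (qneg q) (qden r))).

Definition qadd (q r : term) : term :=
  mkq (add (mul (qpos q) (qden r)) (mul (qpos r) (qden q)))
      (add (mul (qneg q) (qden r)) (mul (qneg r) (qden q)))
      (mul (qden q) (qden r)).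

Definition qone : term := mkq one Zero one.

Definition qhalfpow (t : term) : term := mkq one Zero (exp two t).

(** The function variable 0 is [gamma] in the premise; in the conclusion [gamma]
    is 1 and [zeta] is 0. *)
Definition Ded : form :=
  All1
    (All0 (qle (FVar 0 @ Var 0) (FVar 0 @ (Sc (Var 0)))
           /\ qle (FVar 0 @ (Sc (Var 0))) qone) -->
     Ex1
       (All0 (lt (FVar 0 @ Var 0) (FVar 0 @ (Sc (Var 0))))
        /\ All0 (qle (FVar 1 @ FVar 0 @ (Sc (Var 0)))
                     (qadd (FVar 1 @ FVar 0 @ Var 0)
                           (qhalfpow (Var 0)))))).

Definition LPO : form :=
  All1 (Ex0 (~ (FVar 0 @ Var 0 =_0 Zero)) \/ All0 (FVar 0 @ Var 0 =_0 Zero)).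

(* Main.v *)
From Stdlib Require Import List.
From Stdlib Require Import -(notations) Setoid Morphisms.
Require Import Defs.
Import ListNotations.

(** Let [gamma 0 = -2], and let [gamma (n + 1)] be [gamma n] if [alpha n = 0] and
    [0] otherwise, so that [gamma] jumps to [0] for good as soon as a nonzero
    value of [alpha] is met. Let [zeta] be given by Ded. If [gamma (zeta 0) = 0],
    a nonzero value of [alpha] has been found. If [gamma (zeta 0) = -2], then
    [gamma (zeta n) = -2] for all [n], as steps of at most [1 / 2 ^ n <= 1] cannot
    make the jump; since [n <= zeta n], the jump never happens, and [alpha] is zero. *)

Notation "G ⊢ A" := (deriv BIM G A) (at level 95, no associativity).

Ltac hyp := apply d_hyp; repeat (first [left; reflexivity | right]).

(** * Structural rules of the calculus and laws of substitution *)

Lemma weakening Ax G A :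
  deriv Ax G A -> forall G', incl G G' -> deriv Ax G' A.
Proof.
  induction 1; intros G' HG;
    [eapply d_ax | eapply d_hyp | eapply d_botE | eapply d_andI | eapply d_andE1
    | eapply d_andE2 | eapply d_orI1 | eapply d_orI2 | eapply d_orE | eapply d_impI
    | eapply d_impE | eapply d_all0I | eapply d_all0E | eapply d_ex0I | eapply d_ex0E
    | eapply d_all1I | eapply d_all1E | eapply d_ex1I | eapply d_ex1E | eapply d_refl0
    | eapply d_leib0 | eapply d_refl1 | eapply d_leib1];
    eauto using incl_map, incl_cons, incl_tl, in_eq.
Qed.

(** Serves to trade an arbitrary context for the explicit list of hypotheses in use, whose shifts
    under the quantifier rules then compute. *)
Lemma cut G D A : Forall (deriv BIM G) D -> D ⊢ A -> G ⊢ A.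
Proof.
  intros HD; revert A. induction HD as [|B D HB HD IH]; intros A HA.
  - apply weakening with []; trivial. intros B [].
  - apply d_impE with B; trivial. now apply IH, d_impI.
Qed.

Lemma fsubst_FVar f : fsubst FVar f = f.
Proof. now destruct f. Qed.

Lemma tsubst_tshift0 sn sf t :
  tsubst sn sf (tshift0 t) = tsubst (fun i => sn (S i)) sf t.
Proof.
  unfold tshift0; induction t; cbn; try congruence.
  rewrite fsubst_FVar; congruence.
Qed.

Lemma tsubst_Var t : tsubst Var FVar t = t.
Proof. induction t; cbn; rewrite ?fsubst_FVar; congruence. Qed.

Lemma tsubst_inst_tshift0 s t : tsubst (scons s Var) FVar (tshift0 t) = t.
Proof. rewrite tsubst_tshift0; apply tsubst_Var. Qed.

(** * Provable equality as a congruence, for setoid rewriting *)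

Lemma leibniz G A s t B C :
  G ⊢ s =_0 t -> inst0 s A = B -> inst0 t A = C -> G ⊢ B -> G ⊢ C.
Proof. intros He <- <-. now apply d_leib0. Qed.

Definition teq (G : list form) (s t : term) : Prop := G ⊢ s =_0 t.

#[global] Instance teq_equivalence G : Equivalence (teq G).
Proof.
  assert (Hs : Symmetric (teq G)).
  { intros s t Hst.
    (* In such templates [Var 0] marks the occurrence to be replaced, and [tshift0] shields the
       other terms from the instantiation. *)
    apply (leibniz G (Var 0 =_0 tshift0 s) s t (s =_0 s)); trivial;
      try apply d_refl0; cbn; now rewrite tsubst_inst_tshift0. }
  split; trivial.
  - intros s; apply d_refl0.
  - intros s t u Hst Htu.
    apply (leibniz G (tshift0 s =_0 Var 0) t u (s =_0 t)); trivial;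
      cbn; now rewrite tsubst_inst_tshift0.
Qed.

#[global] Instance App_proper G f : Proper (respectful (teq G) (teq G)) (App f).
Proof.
  intros s t Hst.
  apply (leibniz G (f @ tshift0 s =_0 f @ Var 0) s t (f @ s =_0 f @ s)); trivial;
    try apply d_refl0; cbn; now rewrite tsubst_inst_tshift0, fsubst_FVar.
Qed.

#[global] Instance Pr_proper G : Proper (respectful (teq G) (respectful (teq G) (teq G))) Pr.
Proof.
  intros s t Hst u v Huv. transitivity (Pr s v).
  - apply (leibniz G (Pr (tshift0 s) (tshift0 u) =_0 Pr (tshift0 s) (Var 0)) u v
             (Pr s u =_0 Pr s u)); trivial;
      try apply d_refl0; cbn; now rewrite ?tsubst_inst_tshift0.
  - apply (leibniz G (Pr (tshift0 s) (tshift0 v) =_0 Pr (Var 0) (tshift0 v)) s t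
             (Pr s v =_0 Pr s v)); trivial;
      try apply d_refl0; cbn; now rewrite ?tsubst_inst_tshift0.
Qed.

#[global] Instance add_proper G : Proper (respectful (teq G) (respectful (teq G) (teq G))) add.
Proof. intros s t Hst u v Huv. unfold add. now rewrite Hst, Huv. Qed.

#[global] Instance mul_proper G : Proper (respectful (teq G) (respectful (teq G) (teq G))) mul.
Proof. intros s t Hst u v Huv. unfold mul. now rewrite Hst, Huv. Qed.

(** * Defining equations and elementary arithmetic *)

Lemma teq_fst G s t : teq G (Fst (Pr s t)) s.
Proof. apply d_ax, ax_fst. Qed.
Lemma teq_snd G s t : teq G (Snd (Pr s t)) t.
Proof. apply d_ax, ax_snd. Qed.
Lemma teq_id G t : teq G (pId @ t) t.
Proof. apply d_ax, ax_id. Qed.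
Lemma teq_zero G t : teq G (pZero @ t) Zero.
Proof. apply d_ax, ax_zero. Qed.
Lemma teq_comp G f g t : teq G (pComp f g @ t) (f @ g @ t).
Proof. apply d_ax, ax_comp. Qed.
Lemma teq_pair G f g t : teq G (pPair f g @ t) (Pr (f @ t) (g @ t)).
Proof. apply d_ax, ax_pPair. Qed.
Lemma teq_rec0 G f g s : teq G (pRec f g @ Pr s Zero) (f @ s).
Proof. apply d_ax, ax_rec0. Qed.
Lemma teq_recS G f g s t :
  teq G (pRec f g @ Pr s (Sc t)) (g @ Pr (Pr s t) (pRec f g @ Pr s t)).
Proof. apply d_ax, ax_recS. Qed.

Hint Rewrite teq_fst teq_snd teq_id teq_zero teq_comp teq_pair : prim.

Lemma teq_add0 G s : teq G (add s Zero) s.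
Proof. unfold add, pAdd. now rewrite teq_rec0, teq_id. Qed.

Lemma teq_addS G s t : teq G (add s (Sc t)) (Sc (add s t)).
Proof. unfold add, pAdd. rewrite teq_recS. now autorewrite with prim. Qed.

Lemma teq_mul0 G s : teq G (mul s Zero) Zero.
Proof. unfold mul, pMul. now rewrite teq_rec0, teq_zero. Qed.

Lemma teq_mulS G s t : teq G (mul s (Sc t)) (add (mul s t) s).
Proof. unfold mul, pMul. rewrite teq_recS. now autorewrite with prim. Qed.

Lemma induction_rule G A :
  G ⊢ inst0 Zero A -> A :: map shift0 G ⊢ succ0 A -> G ⊢ All0 A.
Proof.
  intros H0 HS. apply d_impE with (All0 (A --> succ0 A)).
  - apply d_impE with (inst0 Zero A); trivial. apply d_ax, ax_ind.
  - apply d_all0I, d_impI, HS.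
Qed.

Lemma teq_all G s t u :
  G ⊢ All0 (s =_0 t) -> teq G (tsubst (scons u Var) FVar s) (tsubst (scons u Var) FVar t).
Proof. intros H; exact (d_all0E _ _ _ u H). Qed.

Lemma teq_0add G t : teq G (add Zero t) t.
Proof.
  apply (teq_all G (add Zero (Var 0)) (Var 0) t), induction_rule.
  - exact (teq_add0 _ _).
  - set (G' := _ :: _). change (teq G' (add Zero (Sc (Var 0))) (Sc (Var 0))).
    assert (IH : teq G' (add Zero (Var 0)) (Var 0)) by hyp.
    now rewrite teq_addS, IH.
Qed.

Lemma teq_0mul G t : teq G (mul Zero t) Zero.
Proof.
  apply (teq_all G (mul Zero (Var 0)) Zero t), induction_rule.
  - exact (teq_mul0 _ _).
  - set (G' := _ :: _). change (teq G' (mul Zero (Sc (Var 0))) Zero).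
    assert (IH : teq G' (mul Zero (Var 0)) Zero) by hyp.
    now rewrite teq_mulS, IH, teq_add0.
Qed.

Lemma teq_Sadd G s t : teq G (add (Sc s) t) (Sc (add s t)).
Proof.
  (* Displaying [s] as an instance of its shift turns the goal into the instance at [t] of an
     equation with induction variable [Var 0]. *)
  rewrite <- (tsubst_inst_tshift0 t s).
  apply (teq_all G (add (Sc (tshift0 s)) (Var 0)) (Sc (add (tshift0 s) (Var 0))) t).
  apply induction_rule.
  - cbn. rewrite tsubst_inst_tshift0.
    change (teq G (add (Sc s) Zero) (Sc (add s Zero))). now rewrite !teq_add0.
  - set (G' := _ :: _). cbn. rewrite tsubst_tshift0. fold (tshift0 s).
    change (teq G' (add (Sc (tshift0 s)) (Sc (Var 0))) (Sc (add (tshift0 s) (Sc (Var 0))))).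
    assert (IH : teq G' (add (Sc (tshift0 s)) (Var 0)) (Sc (add (tshift0 s) (Var 0)))) by hyp.
    now rewrite !teq_addS, IH.
Qed.

Lemma teq_addA G s t u : teq G (add (add s t) u) (add s (add t u)).
Proof.
  rewrite <- (tsubst_inst_tshift0 u s), <- (tsubst_inst_tshift0 u t).
  apply (teq_all G (add (add (tshift0 s) (tshift0 t)) (Var 0))
                   (add (tshift0 s) (add (tshift0 t) (Var 0))) u).
  apply induction_rule.
  - cbn. rewrite !tsubst_inst_tshift0.
    change (teq G (add (add s t) Zero) (add s (add t Zero))). now rewrite !teq_add0.
  - set (G' := _ :: _). cbn. rewrite !tsubst_tshift0. fold (tshift0 s) (tshift0 t).
    change (teq G' (add (add (tshift0 s) (tshift0 t)) (Sc (Var 0)))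
                   (add (tshift0 s) (add (tshift0 t) (Sc (Var 0))))).
    assert (IH : teq G' (add (add (tshift0 s) (tshift0 t)) (Var 0))
                        (add (tshift0 s) (add (tshift0 t) (Var 0)))) by hyp.
    now rewrite !teq_addS, IH.
Qed.

(** * Case distinction on numbers, and order *)

Lemma teq_S0_absurd G t A : teq G (Sc t) Zero -> G ⊢ A.
Proof. intros H. apply d_botE, (d_impE _ _ _ _ (d_ax _ _ _ (ax_succ_neq0 t)) H). Qed.

Lemma teq_S_inj G s t : teq G (Sc s) (Sc t) -> teq G s t.
Proof. intros H. exact (d_impE _ _ _ _ (d_ax _ _ _ (ax_succ_inj s t)) H). Qed.

(** Intuitionistic logic does not supply this split; it comes from induction, where both cases are
    immediate. The predecessor becomes the new [Var 0]. *)
Lemma zero_or_succ G t C :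
  (t =_0 Zero) :: G ⊢ C ->
  (tshift0 t =_0 Sc (Var 0)) :: map shift0 G ⊢ shift0 C ->
  G ⊢ C.
Proof.
  intros H0 HS.
  apply d_orE with (t =_0 Zero) (Ex0 (tshift0 t =_0 Sc (Var 0))); trivial.
  - assert (HA : G ⊢ All0 (Var 0 =_0 Zero \/ Ex0 (Var 1 =_0 Sc (Var 0)))).
    { apply induction_rule.
      - apply d_orI1, d_refl0.
      - apply d_orI2. apply d_ex0I with (Var 0). exact (d_refl0 _ _ (Sc (Var 0))). }
    exact (d_all0E _ _ _ t HA).
  - apply d_ex0E with (tshift0 t =_0 Sc (Var 0)); [hyp|].
    apply weakening with (1 := HS). intros B [<-|HB]; [apply in_eq|].
    right; right. exact HB.
Qed.

Lemma le_intro G s t u : teq G (add s u) t -> G ⊢ le s t.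
Proof.
  intros H. apply d_ex0I with u. cbn. now rewrite !tsubst_inst_tshift0.
Qed.

Lemma le_elim G s t C :
  G ⊢ le s t ->
  (add (tshift0 s) (Var 0) =_0 tshift0 t) :: map shift0 G ⊢ shift0 C ->
  G ⊢ C.
Proof. apply d_ex0E. Qed.

Lemma le_proper G s s' t t' :
  teq G s s' -> teq G t t' -> G ⊢ le s t -> G ⊢ le s' t'.
Proof.
  intros Hs Ht H.
  apply (leibniz G (le (tshift0 s') (Var 0)) t t' (le s' t)); trivial.
  1,2: unfold le; cbn; now rewrite !tsubst_tshift0.
  apply (leibniz G (le (Var 0) (tshift0 t)) s s' (le s t)); trivial.
  all: unfold le; cbn; now rewrite !tsubst_tshift0.
Qed.

Lemma le_SS_one_absurd G t A : G ⊢ le (Sc (Sc t)) one -> G ⊢ A.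
Proof.
  intros H. apply d_botE, (le_elim _ _ _ _ H). set (G' := _ :: _).
  assert (E : teq G' (add (Sc (Sc (tshift0 t))) (Var 0)) one) by hyp.
  rewrite !teq_Sadd in E. exact (teq_S0_absurd _ _ _ (teq_S_inj _ _ _ E)).
Qed.

(** * The two rational values of the sequence *)

(** [low] codes -2 and [high] codes 0. The gap has to exceed 1, the step allowed by [Ded] at index
    0. *)
Definition low : term := Pr (Pr Zero two) Zero.
Definition high : term := Pr (Pr Zero Zero) Zero.

Lemma low_high_absurd G A : teq G low high -> G ⊢ A.
Proof.
  intros H. apply (teq_S0_absurd G one).
  rewrite <- (teq_snd G Zero two), <- (teq_fst G (Pr Zero two) Zero).
  fold low. rewrite H. unfold high. now autorewrite with prim.
Qed.

Lemma qle_refl G q : G ⊢ qle q q.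
Proof. apply le_intro with Zero, teq_add0. Qed.

(** Both products on the left of the cross-multiplied inequality vanish. *)
Lemma qle_of_zeros G q r : teq G (qpos q) Zero -> teq G (qneg r) Zero -> G ⊢ qle q r.
Proof.
  intros Hq Hr. eapply le_intro. rewrite Hq, Hr, !teq_0mul, teq_0add. apply teq_0add.
Qed.

Lemma qle_proper G q q' r r' :
  teq G q q' -> teq G r r' -> G ⊢ qle q r -> G ⊢ qle q' r'.
Proof.
  intros Hq Hr. apply le_proper; unfold qpos, qneg, qden; now rewrite Hq, Hr.
Qed.

Lemma high_le_low_absurd G t A : G ⊢ qle high (qadd low (qhalfpow t)) -> G ⊢ A.
Proof.
  (* [low + 1 / (p + 1)] is below [high] whatever [p] is, so the value of the power
     is irrelevant. *)
  unfold qadd, qhalfpow, mkq. generalize (pred (exp two t)); intros p.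
  generalize (pred (mul (qden low) (qden (Pr (Pr one Zero) p)))); intros r H.
  (* Since both parts of the numerator of [high] are zero, [r] drops out and cross-multiplication
     leaves [2 * p + 2 <= 1]. *)
  apply (le_SS_one_absurd G (mul two p)).
  apply le_proper with (3 := H); unfold qpos, qneg, qden, high, low.
  - rewrite !teq_fst, !teq_snd, !teq_0mul, !teq_mulS.
    rewrite !teq_addS, !teq_mul0, !teq_0add, !teq_add0. reflexivity.
  - rewrite !teq_fst, !teq_snd, !teq_0mul, !teq_mulS.
    rewrite !teq_addS, !teq_mul0, !teq_0add, !teq_add0. reflexivity.
Qed.

(** * Existence of gamma *)

(** A test for zero on the second argument, encoded as a recursion whose step ignores the previous
    value. *)
Definition pStep : prim := pRec pId (pPair (pPair pZero pZero) pZero).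
Definition pLow : prim :=
  pPair (pPair pZero (pComp pSucc (pComp pSucc pZero))) pZero.

Lemma teq_step0 G s : teq G (pStep @ Pr s Zero) s.
Proof. unfold pStep. now rewrite teq_rec0, teq_id. Qed.

Lemma teq_stepS G s t : teq G (pStep @ Pr s (Sc t)) high.
Proof. unfold pStep, high. now rewrite teq_recS, !teq_pair, !teq_zero. Qed.

Lemma teq_low G t : teq G (pLow @ t) low.
Proof. unfold pLow, low. now rewrite !teq_pair, !teq_comp, !teq_zero. Qed.

(** [FVar g] is the sequence [gamma] belonging to [FVar a] as [alpha]. *)
Definition drop_spec (a g : nat) : form :=
  FVar g @ Zero =_0 low
  /\ All0 (FVar g @ Sc (Var 0) =_0 pStep @ Pr (FVar g @ Var 0) (FVar a @ Var 0)).

Lemma comp_exists G f g :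
  G ⊢ Ex1 (All0 (FVar 0 @ Var 0 =_0 fsubst upFVar f @ fsubst upFVar g @ Var 0)).
Proof.
  assert (H := d_all1E _ G _ f (d_ax _ _ _ ax_closed_comp)). cbn in H.
  apply d_all1E with (f := g) in H. destruct f, g; exact H.
Qed.

Lemma rec_exists G f g :
  G ⊢ Ex1 (All0 (FVar 0 @ (Pr (Var 0) Zero) =_0 fsubst upFVar f @ Var 0
             /\ All0 (FVar 0 @ (Pr (Var 1) (Sc (Var 0)))
                      =_0 fsubst upFVar g @ (Pr (Pr (Var 1) (Var 0))
                                       (FVar 0 @ (Pr (Var 1) (Var 0))))))).
Proof.
  assert (H := d_all1E _ G _ f (d_ax _ _ _ ax_closed_rec)). cbn in H.
  apply d_all1E with (f := g) in H. destruct f, g; exact H.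
Qed.

Lemma drop_exists : [] ⊢ All1 (Ex1 (drop_spec 1 0)).
Proof.
  apply d_all1I.
  (* The step function [((m, n), c) |-> pStep (c, alpha n)] mixes its argument with
     a value of [alpha]. As function variables cannot be paired, it is
     obtained as a one-step recursion, evaluated at 1. *)
  eapply d_ex1E; [apply (comp_exists _ (FVar 0) (pComp pSnd pFst))|].
  eapply d_ex1E; [apply (rec_exists _ (FVar 0)
    (pComp pStep (pPair (pComp pSnd (pComp pFst pFst)) pSnd)))|].
  eapply d_ex1E; [apply (comp_exists _ (FVar 0) (pPair pId (pComp pSucc pZero)))|].
  eapply d_ex1E; [apply (rec_exists _ pLow (FVar 0))|].
  eapply d_ex1E; [apply (comp_exists _ (FVar 0) (pPair pZero pId))|].
  apply d_ex1I with (FVar 0).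
  (* Now [FVar 5] is alpha; [FVar 4] sends ((m, n), c) to alpha n; [FVar 3] is the one-step
     recursion and [FVar 2] its value at 1; [FVar 1] is the recursion for gamma with a dummy
     parameter, which [FVar 0] fixes to be zero. *)
  match goal with |- ?G' ⊢ _ => set (G := G') end.
  change (G ⊢ drop_spec 5 0).
  assert (H0 : forall t, teq G (FVar 0 @ t) (FVar 1 @ pPair pZero pId @ t)).
  { intros t.
    refine (d_all0E _ G (FVar 0 @ Var 0 =_0 FVar 1 @ pPair pZero pId @ Var 0) t _). hyp. }
  assert (H1 : G ⊢ FVar 1 @ Pr Zero Zero =_0 pLow @ Zero
             /\ All0 (FVar 1 @ (Pr Zero (Sc (Var 0)))
                      =_0 FVar 2 @ Pr (Pr Zero (Var 0)) (FVar 1 @ Pr Zero (Var 0)))).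
  { refine (d_all0E _ G (FVar 1 @ Pr (Var 0) Zero =_0 pLow @ Var 0
             /\ All0 (FVar 1 @ (Pr (Var 1) (Sc (Var 0)))
                      =_0 FVar 2 @ Pr (Pr (Var 1) (Var 0)) (FVar 1 @ Pr (Var 1) (Var 0)))) Zero _).
    hyp. }
  assert (H10 : teq G (FVar 1 @ Pr Zero Zero) (pLow @ Zero)) by exact (d_andE1 _ _ _ _ H1).
  assert (H1S : forall t, teq G (FVar 1 @ Pr Zero (Sc t))
                                (FVar 2 @ Pr (Pr Zero t) (FVar 1 @ Pr Zero t)))
    by (intros t; exact (d_all0E _ _ _ t (d_andE2 _ _ _ _ H1))).
  assert (H2 : forall t, teq G (FVar 2 @ t) (FVar 3 @ pPair pId (pComp pSucc pZero) @ t)).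
  { intros t.
    refine (d_all0E _ G (FVar 2 @ Var 0 =_0 FVar 3 @ pPair pId (pComp pSucc pZero) @ Var 0) t _).
    hyp. }
  set (p := pComp pStep (pPair (pComp pSnd (pComp pFst pFst)) pSnd)) in G.
  assert (H3 : forall t, G ⊢ FVar 3 @ Pr t Zero =_0 FVar 4 @ t
             /\ All0 (FVar 3 @ (Pr (tshift0 t) (Sc (Var 0)))
                      =_0 p @ Pr (Pr (tshift0 t) (Var 0)) (FVar 3 @ Pr (tshift0 t) (Var 0)))).
  { intros t. refine (d_all0E _ G (FVar 3 @ Pr (Var 0) Zero =_0 FVar 4 @ Var 0
             /\ All0 (FVar 3 @ (Pr (Var 1) (Sc (Var 0)))
                      =_0 p @ Pr (Pr (Var 1) (Var 0)) (FVar 3 @ Pr (Var 1) (Var 0)))) t _).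
    hyp. }
  assert (H30 : forall t, teq G (FVar 3 @ Pr t Zero) (FVar 4 @ t))
    by (intros t; exact (d_andE1 _ _ _ _ (H3 t))).
  assert (H31 : forall t, teq G (FVar 3 @ Pr t one) (p @ Pr (Pr t Zero) (FVar 3 @ Pr t Zero))).
  { intros t. assert (H := d_all0E _ _ _ Zero (d_andE2 _ _ _ _ (H3 t))).
    cbn in H. rewrite tsubst_inst_tshift0 in H. exact H. }
  assert (H4 : forall t, teq G (FVar 4 @ t) (FVar 5 @ pComp pSnd pFst @ t)).
  { intros t.
    refine (d_all0E _ G (FVar 4 @ Var 0 =_0 FVar 5 @ pComp pSnd pFst @ Var 0) t _). hyp. }
  apply d_andI.
  - change (teq G (FVar 0 @ Zero) low).
    now rewrite H0, teq_pair, teq_zero, teq_id, H10, teq_low.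
  - apply d_all0I. change (teq G (FVar 0 @ Sc (Var 0))
                                 (pStep @ Pr (FVar 0 @ Var 0) (FVar 5 @ Var 0))).
    rewrite !H0, !teq_pair, !teq_zero, !teq_id, H1S, H2, teq_pair, teq_id, teq_comp, teq_zero.
    rewrite H31, H30, H4. unfold p.
    now rewrite !teq_comp, !teq_pair, !teq_comp, !teq_fst, !teq_snd.
Qed.

(** * Values and monotonicity of gamma *)

Lemma drop_zero a g G : G ⊢ drop_spec a g -> teq G (FVar g @ Zero) low.
Proof. intros H. exact (d_andE1 _ _ _ _ H). Qed.

Lemma drop_succ a g G t :
  G ⊢ drop_spec a g ->
  teq G (FVar g @ Sc t) (pStep @ Pr (FVar g @ t) (FVar a @ t)).
Proof. intros H. exact (d_all0E _ _ _ t (d_andE2 _ _ _ _ H)). Qed.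

(** The value [high] is bundled with the existential, so that deciding one value of gamma can
    directly yield the first alternative of [LPO]. *)
Definition low_or_dropped (a g : nat) (t : term) : form :=
  FVar g @ t =_0 low
  \/ (FVar g @ t =_0 high /\ Ex0 (~ (FVar a @ Var 0 =_0 Zero))).

Lemma low_or_dropped_eq a g G s t :
  teq G (FVar g @ s) (FVar g @ t) ->
  G ⊢ low_or_dropped a g s -> G ⊢ low_or_dropped a g t.
Proof.
  intros He.
  exact (d_leib0 _ _ (Var 0 =_0 low
    \/ (Var 0 =_0 high /\ Ex0 (~ (FVar a @ Var 0 =_0 Zero)))) _ _ He).
Qed.

(** Induction on [t]: where alpha vanishes the previous case carries over; where it does not, that
    argument is the witness. *)
Lemma drop_cases a g G t : G ⊢ drop_spec a g -> G ⊢ low_or_dropped a g t.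
Proof.
  intros H. refine (d_all0E _ _ (low_or_dropped a g (Var 0)) t _).
  apply cut with [drop_spec a g]; [auto|]. clear. apply induction_rule.
  - apply d_orI1. change (teq [drop_spec a g] (FVar g @ Zero) low).
    apply drop_zero with a. hyp.
  - change ([low_or_dropped a g (Var 0); drop_spec a g] ⊢ low_or_dropped a g (Sc (Var 0))).
    apply zero_or_succ with (FVar a @ Var 0).
    + set (G := _ :: _).
      assert (HD : G ⊢ drop_spec a g) by hyp.
      assert (Ha : teq G (FVar a @ Var 0) Zero) by hyp.
      apply low_or_dropped_eq with (Var 0); [|hyp].
      now rewrite (drop_succ _ _ _ _ HD), Ha, teq_step0.
    + set (G := _ :: _). change (G ⊢ low_or_dropped a g (Sc (Var 1))).
      assert (HD : G ⊢ drop_spec a g) by hyp.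
      assert (Ha : teq G (FVar a @ Var 1) (Sc (Var 0))) by hyp.
      apply d_orI2, d_andI.
      * change (teq G (FVar g @ Sc (Var 1)) high).
        now rewrite (drop_succ _ _ _ _ HD), Ha, teq_stepS.
      * apply d_ex0I with (Var 1), d_impI. apply teq_S0_absurd with (Var 0).
        transitivity (FVar a @ Var 1); [symmetry|]; hyp.
Qed.

(** Keeping [high] and resetting to [high] agree, so the two cases of the test coincide. *)
Lemma teq_step_high G t : teq G (pStep @ Pr high t) high.
Proof.
  apply (teq_all G (pStep @ Pr high (Var 0)) high t), induction_rule.
  - apply teq_step0.
  - apply teq_stepS.
Qed.

Lemma drop_persists a g G s t :
  G ⊢ drop_spec a g -> teq G (FVar g @ s) high -> teq G (FVar g @ add s t) high.
Proof.
  intros HD Hs.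
  assert (H : G ⊢ All0 (FVar g @ Var 0 =_0 high
                        --> All0 (FVar g @ add (Var 1) (Var 0) =_0 high))).
  { apply cut with [drop_spec a g]; [auto|]. clear.
    apply d_all0I, d_impI, induction_rule; set (G := _ :: _).
    - change (teq G (FVar g @ add (Var 0) Zero) high). rewrite teq_add0. hyp.
    - change (teq G (FVar g @ add (Var 1) (Sc (Var 0))) high).
      assert (HD : G ⊢ drop_spec a g) by hyp.
      assert (IH : teq G (FVar g @ add (Var 1) (Var 0)) high) by hyp.
      rewrite teq_addS, (drop_succ _ _ _ _ HD), IH. apply teq_step_high. }
  assert (H' := d_all0E _ _ _ t (d_impE _ _ _ _ (d_all0E _ _ _ s H) Hs)).
  cbn in H'. rewrite tsubst_inst_tshift0 in H'. exact H'.
Qed.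

Lemma drop_qpos a g G t : G ⊢ drop_spec a g -> teq G (qpos (FVar g @ t)) Zero.
Proof.
  intros HD. eapply d_orE; [exact (drop_cases a g G t HD)| |];
    match goal with |- ?G' ⊢ _ => set (D := G'); change (teq D (qpos (FVar g @ t)) Zero) end;
    unfold qpos.
  - assert (H : teq D (FVar g @ t) low) by hyp.
    rewrite H. unfold low. now rewrite !teq_fst.
  - assert (H : teq D (FVar g @ t) high) by (eapply d_andE1; hyp).
    rewrite H. unfold high. now rewrite !teq_fst.
Qed.

(** If alpha vanishes at the index, the two consecutive terms coincide; otherwise the later one is
    0. As no term has a positive part, [qle_of_zeros] settles this case and the bound by 1. *)
Lemma drop_premise a g G :
  G ⊢ drop_spec a g ->
  G ⊢ All0 (qle (FVar g @ Var 0) (FVar g @ (Sc (Var 0)))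
            /\ qle (FVar g @ (Sc (Var 0))) qone).
Proof.
  intros HD. apply cut with [drop_spec a g]; [auto|]. clear. apply d_all0I, d_andI.
  - apply zero_or_succ with (FVar a @ Var 0); set (G := _ :: _);
      assert (HD : G ⊢ drop_spec a g) by hyp.
    + assert (Ha : teq G (FVar a @ Var 0) Zero) by hyp.
      apply qle_proper with (FVar g @ Var 0) (FVar g @ Var 0);
        [reflexivity| |apply qle_refl].
      now rewrite (drop_succ _ _ _ _ HD), Ha, teq_step0.
    + assert (Ha : teq G (FVar a @ Var 1) (Sc (Var 0))) by hyp.
      change (G ⊢ qle (FVar g @ Var 1) (FVar g @ Sc (Var 1))).
      apply qle_of_zeros; [now apply drop_qpos with a|].
      unfold qneg. rewrite (drop_succ _ _ _ _ HD), Ha, teq_stepS.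
      unfold high. now rewrite teq_fst, teq_snd.
  - apply qle_of_zeros; [apply drop_qpos with a; hyp|].
    unfold qneg, qone, mkq. now rewrite !teq_fst, teq_snd.
Qed.

(** * The subsequence of gamma along zeta *)

Lemma increasing_ge z G t :
  G ⊢ All0 (lt (FVar z @ Var 0) (FVar z @ (Sc (Var 0)))) -> G ⊢ le t (FVar z @ t).
Proof.
  intros H.
  assert (HA : G ⊢ All0 (le (Var 0) (FVar z @ Var 0))).
  2:{ assert (H' := d_all0E _ _ _ t HA). exact H'. }
  apply cut with [All0 (lt (FVar z @ Var 0) (FVar z @ (Sc (Var 0))))]; [auto|]. clear.
  apply induction_rule; match goal with |- ?G' ⊢ _ => set (G := G') end.
  - change (G ⊢ le Zero (FVar z @ Zero)). apply le_intro with (FVar z @ Zero), teq_0add.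
  - change (G ⊢ le (Sc (Var 0)) (FVar z @ Sc (Var 0))).
    apply le_elim with (Var 0) (FVar z @ Var 0); [hyp|].
    apply le_elim with (Sc (FVar z @ Var 1)) (FVar z @ Sc (Var 1)).
    { refine (d_all0E _ _ (lt (FVar z @ Var 0) (FVar z @ (Sc (Var 0)))) (Var 1) _). hyp. }
    match goal with |- ?G' ⊢ _ => set (G2 := G') end.
    change (G2 ⊢ le (Sc (Var 2)) (FVar z @ Sc (Var 2))).
    assert (E1 : teq G2 (add (Var 2) (Var 1)) (FVar z @ Var 2)) by hyp.
    assert (E2 : teq G2 (add (Sc (FVar z @ Var 2)) (Var 0)) (FVar z @ Sc (Var 2))) by hyp.
    (* With n now [Var 2], the summands are the differences witnessing n <= zeta n and zeta n + 1 <=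
       zeta (n + 1). *)
    apply le_intro with (add (Var 1) (Var 0)).
    now rewrite <- teq_addA, teq_Sadd, E1.
Qed.

Definition small_steps (g z : nat) : form :=
  All0 (qle (FVar g @ FVar z @ (Sc (Var 0)))
            (qadd (FVar g @ FVar z @ Var 0) (qhalfpow (Var 0)))).

(** Induction on [t]: [drop_cases] leaves only the value [high] to refute, and [high_le_low_absurd]
    excludes it by [small_steps]. *)
Lemma stays_low a g z G t :
  G ⊢ drop_spec a g -> G ⊢ small_steps g z ->
  teq G (FVar g @ FVar z @ Zero) low -> teq G (FVar g @ FVar z @ t) low.
Proof.
  intros HD Hs H0. apply (teq_all G (FVar g @ FVar z @ Var 0) low t).
  apply cut with [drop_spec a g; small_steps g z; FVar g @ FVar z @ Zero =_0 low];
    [auto|]. clear.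
  apply induction_rule; [hyp|].
  eapply d_orE; [apply (drop_cases a g) with (t := FVar z @ Sc (Var 0)); hyp|hyp|].
  set (G := _ :: _).
  assert (IH : teq G (FVar g @ FVar z @ Var 0) low) by hyp.
  assert (HS : teq G (FVar g @ FVar z @ Sc (Var 0)) high) by (eapply d_andE1; hyp).
  apply (high_le_low_absurd G (Var 0)).
  apply qle_proper with (FVar g @ FVar z @ Sc (Var 0))
                        (qadd (FVar g @ FVar z @ Var 0) (qhalfpow (Var 0))).
  - exact HS.
  - unfold qadd, mkq, qpos, qneg, qden, pred. now rewrite IH.
  - refine (d_all0E _ _ (qle (FVar g @ FVar z @ (Sc (Var 0)))
            (qadd (FVar g @ FVar z @ Var 0) (qhalfpow (Var 0)))) (Var 0) _). hyp.
Qed.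

Theorem theorem5p2 : provable BIM (Ded --> LPO).
Proof.
  apply d_impI, d_all1I.
  apply d_ex1E with (drop_spec 1 0).
  { refine (d_all1E _ _ (Ex1 (drop_spec 1 0)) (FVar 0) _).
    apply cut with []; [auto|apply drop_exists]. }
  apply d_ex1E with
    (All0 (lt (FVar 0 @ Var 0) (FVar 0 @ Sc (Var 0))) /\ small_steps 1 0).
  { apply d_impE with (All0 (qle (FVar 0 @ Var 0) (FVar 0 @ Sc (Var 0))
                             /\ qle (FVar 0 @ Sc (Var 0)) qone)).
    - refine (d_all1E _ _ (All0 (qle (FVar 0 @ Var 0) (FVar 0 @ Sc (Var 0))
                             /\ qle (FVar 0 @ Sc (Var 0)) qone) -->
        Ex1 (All0 (lt (FVar 0 @ Var 0) (FVar 0 @ Sc (Var 0))) /\ small_steps 1 0))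
        (FVar 0) _). hyp.
    - apply drop_premise with 1. hyp. }
  (* Here [FVar 2] is alpha, [FVar 1] is gamma and [FVar 0] is zeta; the value of gamma at zeta 0
     decides between the alternatives. *)
  eapply d_orE; [apply (drop_cases 2 1) with (t := FVar 0 @ Zero); hyp| |].
  - apply d_orI2, d_all0I. apply zero_or_succ with (FVar 2 @ Var 0); [hyp|].
    (* Index n + 1 instead of n, because a nonzero alpha n shows in gamma only from n + 1 on. Below,
       [Var 2] is n, [Var 1] the predecessor of alpha n, and [Var 0] the difference of zeta (n + 1)
       and n + 1. *)
    apply le_elim with (Sc (Var 1)) (FVar 0 @ Sc (Var 1)).
    { apply increasing_ge. eapply d_andE1. hyp. }
    match goal with |- ?G' ⊢ _ => set (G := G') end.
    assert (HD : G ⊢ drop_spec 2 1) by hyp.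
    assert (Ha : teq G (FVar 2 @ Var 2) (Sc (Var 1))) by hyp.
    assert (Hz : teq G (add (Sc (Var 2)) (Var 0)) (FVar 0 @ Sc (Var 2))) by hyp.
    apply low_high_absurd.
    transitivity (FVar 1 @ FVar 0 @ Sc (Var 2)).
    + symmetry. apply stays_low with 2; [exact HD| |hyp]. eapply d_andE2. hyp.
    + rewrite <- Hz. apply drop_persists with 2; [exact HD|].
      now rewrite (drop_succ _ _ _ _ HD), Ha, teq_stepS.
  - apply d_orI1. eapply d_andE2. hyp.
Qed.
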